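(* Let $p\ge1$ be an integer, let $A=(a_{ij})_{i,j=0,\dots,N-1}$ be an $N\times N$ unitary matrix with constant first row $a_{0j}=1/\sqrt N$, and let $f\in\mathbb C^{N^p}$ be a non-zero vector. Let $Tf=A^{\otimes p}f$. If $\alpha>0$ satisfies $\max_{i,j}|a_{ij}|\le\left(\frac1{\sqrt N}\right)^{\alpha}$, then: (i) The following uncertainty principle holds: $|\mathrm{supp}(f)|\cdot|\mathrm{supp}(Tf)|\ge N^{p\alpha}$. (ii) If $A$ is the $2\times2$ matrix giving rise to the classic Walsh transform, $A=\begin{pmatrix}\frac1{\sqrt2}&\frac1{\sqrt2}\\ \frac1{\sqrt2}&-\frac1{\sqrt2}\end{pmatrix}$ (so $N=2$), then $|\mathrm{supp}(f)|\cdot|\mathrm{supp}(Tf)|\ge N^{p}$. (iii) $\alpha=1$ if and only if $\sqrt N\cdot A$ is a Hadamard matrix, i.e., a matrix with all entries of absolute value one and orthogonal rows/columns. (iv) If $A$ has real entries only and $N>2$, then necessarily $\alpha<1$ unless $N$ is even and $A$ is a $1/\sqrt N$ multiple of a Hadamard matrix.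
   Context: $\mathrm{supp}(f)=\{k: f(k)\ne0\}$ for a vector $f$, and $|\cdot|$ of a set denotes its cardinality. The map $T$ is called the generalized Walsh-Fourier transform corresponding to $A$. Indices start from $0$. Tensor product convention: for $A$ of size $N\times N$ and $B$ of size $M\times M$, $(A\otimes B)_{i_1+Ni_2,\,j_1+Nj_2}=A_{i_1j_1}B_{i_2j_2}$ for $0\le i_1,j_1\le N-1$, $0\le i_2,j_2\le M-1$. $A^{\otimes1}=A$, $A^{\otimes n}=A\otimes A^{\otimes(n-1)}$.
   Formalization: In (iii), which fails for a non-maximal α (Walsh matrix, α=1/2), the claim is stated as: the bound holds with exponent 1 if and only if √N·A is Hadamard; and, if α is the largest exponent satisfying the bound, α=1 if and only if √N·A is Hadamard. *)

(* Defs.v *)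
From HB Require Import structures.
From mathcomp Require Import all_boot all_order all_algebra.
From mathcomp Require Import complex mxtens.
From mathcomp Require Import all_classical all_reals all_analysis.

Set Implicit Arguments.
Unset Strict Implicit.
Unset Printing Implicit Defensive.

Import Order.TTheory GRing.Theory Num.Theory.
Local Open Scope ring_scope.

(* In [tensmx B A] the index of [A] varies fastest, so with the convention
   [A (x) B] at (i1 + N * i2, j1 + N * j2) = A i1 j1 * B i2 j2 the product is
   [tensmx] with swapped arguments; see [tensE]. *)
Definition tens (K : comPzRingType) (N M : nat) (A : 'M[K]_N) (B : 'M[K]_M) :
    'M[K]_(N * M) :=
  castmx (mulnC M N, mulnC M N) (tensmx B A).

Lemma tensE (K : comPzRingType) (N M : nat) (A : 'M[K]_N) (B : 'M[K]_M)
    (i1 j1 : 'I_N) (i2 j2 : 'I_M) (i j : 'I_(N * M)) :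
  i = (i1 + N * i2)%N :> nat -> j = (j1 + N * j2)%N :> nat ->
  tens A B i j = A i1 j1 * B i2 j2.
Proof.
move=> hi hj; rewrite castmxE.
have -> : cast_ord (esym (mulnC M N)) i = mxtens_index (i2, i1).
  by apply: val_inj; rewrite /= hi addnC mulnC.
have -> : cast_ord (esym (mulnC M N)) j = mxtens_index (j2, j1).
  by apply: val_inj; rewrite /= hj addnC mulnC.
by rewrite tensmxE mulrC.
Qed.

(* The value at exponent 0 is a placeholder. *)
Fixpoint tens_exp (K : comPzRingType) (N : nat) (A : 'M[K]_N) (n : nat) :
    'M[K]_(N ^ n) :=
  match n return 'M[K]_(N ^ n) with
  | 0 => 1%:M
  | m.+1 =>
      match m return 'M[K]_(N ^ m) -> 'M[K]_(N ^ m.+1) with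
      | 0 => fun=> A
      | k.+1 => fun B =>
          castmx (esym (expnS N k.+1), esym (expnS N k.+1)) (tens A B)
      end (tens_exp A m)
  end.

Definition supp (K : nmodType) (n : nat) (f : 'cV[K]_n) : {set 'I_n} :=
  [set k | f k 0 != 0]%SET.

Definition walsh_transform (K : comPzRingType) (N p : nat) (A : 'M[K]_N)
    (f : 'cV[K]_(N ^ p)) : 'cV[K]_(N ^ p) :=
  tens_exp A p *m f.

Definition max_modulus (R : realType) (N : nat) (A : 'M[R[i]]_N) : R :=
  \big[Num.max/0]_(i < N) \big[Num.max/0]_(j < N) complex.Re `|A i j|.

Definition exponent_bound (R : realType) (N : nat) (A : 'M[R[i]]_N)
    (alpha : R) : Prop :=
  max_modulus A <= (Num.sqrt N%:R)^-1 `^ alpha.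

Definition hadamard (R : realType) (N : nat) (H : 'M[R[i]]_N) : Prop :=
  [/\ forall i j, `|H i j| = 1,
      forall i1 i2, i1 != i2 -> \sum_j H i1 j * (H i2 j)^* = 0
    & forall j1 j2, j1 != j2 -> \sum_i H i j1 * (H i j2)^* = 0].

Definition walsh2 (R : realType) : 'M[R[i]]_2 :=
  \matrix_(i, j) let a : R[i] := ((Num.sqrt 2)^-1 : R)%:C%C in
    if (i == 1) && (j == 1) then - a else a.

(* Main.v *)
(* A unitary U whose entries are bounded by m satisfies
   |f k| <= m |supp (U f)| max |U f|  (as f = U^* U f)  and
   |U f k| <= m |supp f| max |f|,
   so 1 <= m^2 |supp f| |supp (U f)|.  For U = A^{(x) p} one can take
   m = N^{-p alpha / 2}, because tensor products of unitary matrices are unitary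
   and bounds on entries multiply.
   Rows of A have norm 1, so |a_ij| <= N^{-1/2} forces equality everywhere; in
   the real case a row of signs orthogonal to the constant row makes N even. *)
Require Import Defs.
From HB Require Import structures.
From mathcomp Require Import all_boot all_order all_algebra.
From mathcomp Require Import complex mxtens.
From mathcomp Require Import all_classical all_reals all_analysis.

Set Implicit Arguments.
Unset Strict Implicit.
Unset Printing Implicit Defensive.

Import Order.TTheory GRing.Theory Num.Theory.
Local Open Scope ring_scope.

(** * Tensor powers: unitarity and entry bounds *)

Lemma castmx_unitary (C : numClosedFieldType) (m n : nat) (e : m = n)
    (M : 'M[C]_m) :
  M \is unitarymx -> castmx (e, e) M \is unitarymx.
Proof. by case: n / e; rewrite castmx_id. Qed.

(** Tensor products multiply factorwise, so the product with the adjoint is a tensor product of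
    identities; that is the identity because index pairing is injective. *)
Lemma tens_unitary (C : numClosedFieldType) (N M : nat)
    (A : 'M[C]_N) (B : 'M[C]_M) :
  A \is unitarymx -> B \is unitarymx -> tens A B \is unitarymx.
Proof.
move=> /unitarymxP hA /unitarymxP hB; apply/castmx_unitary/unitarymxP.
rewrite trmx_tens map_mxT tensmx_mul hA hB.
apply/matrixP=> i j; case: (mxtens_indexP i) => i0 i1.
case: (mxtens_indexP j) => j0 j1; rewrite tensmxE !mxE.
by rewrite (inj_eq (can_inj (@mxtens_indexK _ _))) xpair_eqE -natrM mulnb.
Qed.

Lemma tens_exp_unitary (C : numClosedFieldType) (N p : nat) (A : 'M[C]_N) :
  A \is unitarymx -> tens_exp A p \is unitarymx.
Proof.
(* Exponent 0 is split off because [tens_exp A 1] is [A] itself, not a product with the placeholder;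
   the induction starts at exponent 1. *)
move=> hA; case: p => [|p].
  by apply/unitarymxP; rewrite trmx1 map_mx1 mulmx1.
by elim: p => // p IHp; exact/castmx_unitary/tens_unitary.
Qed.

Lemma tens_norm_le (K : numDomainType) (N M : nat)
    (A : 'M[K]_N) (B : 'M[K]_M) (a b : K) :
  (forall i j, `|A i j| <= a) -> (forall i j, `|B i j| <= b) ->
  forall i j, `|tens A B i j| <= a * b.
Proof.
by move=> hA hB i j; rewrite castmxE mxE normrM mulrC ler_pM.
Qed.

Lemma tens_exp_norm_le (K : numDomainType) (N p : nat) (A : 'M[K]_N) (a : K) :
  (forall i j, `|A i j| <= a) ->
  forall i j, `|tens_exp A p i j| <= a ^+ p.
Proof.
move=> hA; case: p => [|p].
  by move=> i j; rewrite mxE expr0; case: eqP; rewrite ?normr1 ?normr0.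
elim: p => // p IHp i j.
by rewrite [tens_exp _ _]/= castmxE exprS; exact: tens_norm_le.
Qed.

(** * Uncertainty principle for an arbitrary unitary matrix *)

Lemma sum_norm_le_supp (K : numDomainType) (n : nat) (g : 'cV[K]_n) (c : K) :
  (forall k, `|g k 0| <= c) -> \sum_k `|g k 0| <= c *+ #|supp g|.
Proof.
move=> hg; rewrite (bigID (mem (supp g))) /=.
rewrite [X in _ + X]big1 ?addr0; last first.
  by move=> k; rewrite inE negbK => /eqP->; rewrite normr0.
by rewrite -sumr_const ler_sum.
Qed.

Lemma mulmx_norm_le (K : numDomainType) (n : nat) (U : 'M[K]_n)
    (g : 'cV[K]_n) (m c : K) :
  0 <= m -> (forall i j, `|U i j| <= m) -> (forall k, `|g k 0| <= c) ->
  forall k, `|(U *m g) k 0| <= m * (c *+ #|supp g|).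
Proof.
move=> m0 hU hg k; rewrite mxE (le_trans (ler_norm_sum _ _ _)) //.
apply: (@le_trans _ _ (\sum_j m * `|g j 0|)).
  by apply: ler_sum => j _; rewrite normrM ler_wpM2r.
by rewrite -mulr_sumr ler_wpM2l // sum_norm_le_supp.
Qed.

Lemma unitary_uncertainty (C : numClosedFieldType) (n : nat) (U : 'M[C]_n)
    (f : 'cV[C]_n) (m : C) :
  U \is unitarymx -> 0 <= m -> (forall i j, `|U i j| <= m) -> f != 0 ->
  1 <= m ^+ 2 * (#|supp f| * #|supp (U *m f)|)%:R.
Proof.
move=> hU m0 Um f0.
have [k0 fk0] : exists k, f k 0 != 0.
  apply/existsP; apply: contraNT f0 => /existsPn f0.
  apply/eqP/matrixP=> i j; rewrite mxE ord1.
  by apply/eqP; rewrite -[_ == _]negbK; exact: f0.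
(* The order on [C] is only partial, but moduli are real, so a largest entry [f k] exists. *)
have [k _ kmax] := @real_arg_maxP C _ k0 xpredT (fun k => `|f k 0|) erefl
  (fun i _ => normr_real (f i 0)).
have fk_gt0 : 0 < `|f k 0|.
  by rewrite (lt_le_trans _ (kmax k0 erefl)) // normr_gt0.
have fE : U^t*%sesqui *m (U *m f) = f.
  by rewrite -invmx_unitary // mulKmx // unitarymx_unit.
have U'm i j : `|(U^t*%sesqui) i j| <= m by rewrite !mxE norm_conjC.
(* The inner bound is for [U] acting on [f], the outer one for the adjoint acting on [U *m f]; at
   [k] both sides contain the factor [|f k|], which is then cancelled. *)
have h := mulmx_norm_le m0 U'm (mulmx_norm_le m0 Um (fun i => kmax i erefl)) k.
rewrite fE !mulrnAr -mulrnA mulrA -expr2 in h.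
by rewrite -(ler_pM2r fk_gt0) mul1r mulr_natr mulrnAl.
Qed.

(** * Admissible exponents and Hadamard matrices *)

Section ExponentBound.
Variables (R : realType) (N : nat).
Implicit Types (A : 'M[R[i]]_N) (alpha : R).

Local Notation s := (Num.sqrt N%:R : R).

(** Moduli are real elements of [R[i]], so [complex.Re] loses nothing and the bound can be used
    entrywise. *)
Lemma exponent_boundP A alpha :
  exponent_bound A alpha <-> forall i j, `|A i j| <= (s^-1 `^ alpha)%:C%C.
Proof.
have ReE i j : (complex.Re `|A i j|)%:C%C = `|A i j|.
  by rewrite RRe_real // normr_real.
split=> [h i j | h].
  rewrite -ReE lecR (le_trans _ h) //.
  pose r i := \big[Num.max/0]_(j < N) complex.Re `|A i j|.
  exact: le_trans (le_bigmax 0 _ j) (le_bigmax 0 r i).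
(* The default 0 of the maxima is harmless, since the power is nonnegative. *)
apply: bigmax_le; first exact: powR_ge0.
move=> i _; apply: bigmax_le; first exact: powR_ge0.
by move=> j _; rewrite -lecR ReE.
Qed.

Lemma powR_sqrtV1 : s^-1 `^ 1 = s^-1.
Proof. by rewrite powRr1 // invr_ge0 sqrtr_ge0. Qed.

Lemma uncertainty A (p : nat) (f : 'cV[R[i]]_(N ^ p)) alpha :
  (0 < N)%N -> A \is unitarymx -> f != 0 -> exponent_bound A alpha ->
  N%:R `^ (p%:R * alpha)
    <= (#|supp f| * #|supp (walsh_transform A f)|)%:R :> R.
Proof.
move=> N0 hA f0 /exponent_boundP Aa.
have NR0 : 0 < N%:R :> R by rewrite ltr0n.
set a := (s^-1 `^ alpha) in Aa.
have a0 : 0 <= a by exact: powR_ge0.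
have aC0 : 0 <= a%:C%C ^+ p :> R[i] by rewrite exprn_ge0 // ler0c.
have := unitary_uncertainty (tens_exp_unitary p hA) aC0 (tens_exp_norm_le Aa) f0.
rewrite -/(walsh_transform A f) -exprM -rmorphXn -[_%:R](rmorph_nat (real_complex R)).
rewrite -rmorphM -[1](rmorph1 (real_complex R)) lecR => h.
(* Here [a] is [N^(-alpha/2)]; entries of the tensor power are bounded by [a ^+ p], and the
   uncertainty bound squares this. *)
have aE : a ^+ (p * 2) = (N%:R `^ (p%:R * alpha))^-1.
  rewrite -powR_mulrn // /a -powRrM natrM mulrA [alpha * _]mulrC [_ * 2]mulrC.
  rewrite [LHS]powRrM powR_mulrn ?invr_ge0 ?sqrtr_ge0 // exprVn sqr_sqrtr //.
  by rewrite -powR_inv1 ?ler0n // -powRrM mulN1r powRN.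
by rewrite aE mulrC ler_pdivlMr ?powR_gt0 // mul1r in h.
Qed.

Lemma scale_sqrtK A :
  (0 < N)%N -> A = (s^-1)%:C%C *: (s%:C%C *: A).
Proof.
move=> N0; rewrite scalerA -rmorphM mulVf ?rmorph1 ?scale1r //.
by rewrite gt_eqF // sqrtr_gt0 ltr0n.
Qed.

Lemma hadamard_exponent_bound1 A :
  (0 < N)%N -> hadamard (s%:C%C *: A) -> exponent_bound A 1.
Proof.
move=> N0 [H1 _ _]; apply/exponent_boundP => i j.
rewrite powR_sqrtV1 {1}(scale_sqrtK A) // mxE normrM H1 mulr1.
by rewrite ger0_norm // ler0c invr_ge0 sqrtr_ge0.
Qed.

Lemma unitary_exponent_bound1_norm A :
  (0 < N)%N -> A \is unitarymx -> exponent_bound A 1 ->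
  forall i j, `|A i j| = (s^-1)%:C%C.
Proof.
move=> N0 /unitarymxP hA /exponent_boundP; rewrite powR_sqrtV1 => Ab i j.
have b0 : 0 <= (s^-1)%:C%C by rewrite ler0c invr_ge0 sqrtr_ge0.
have sqE : (s^-1)%:C%C ^+ 2 = N%:R^-1 :> R[i].
  by rewrite -rmorphXn exprVn sqr_sqrtr ?ler0n // fmorphV rmorph_nat.
have gap0 k : 0 <= (s^-1)%:C%C ^+ 2 - `|A i k| ^+ 2.
  by rewrite subr_ge0 lerXn2r ?nnegrE.
have nrm1 : \sum_k `|A i k| ^+ 2 = 1.
  have := congr1 (fun M : 'M[R[i]]_N => M i i) hA; rewrite !mxE eqxx => h.
  by rewrite -[RHS]/(true%:R) -h; apply: eq_bigr => k _; rewrite !mxE normCK.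
(* The [N] gaps [1/N - |A i k|^2] are nonnegative and add up to [1 - 1], so each of them
   vanishes. *)
have sum0 : \sum_k ((s^-1)%:C%C ^+ 2 - `|A i k| ^+ 2) = 0.
  rewrite sumrB nrm1 sumr_const card_ord sqE -[_ *+ N]mulr_natl.
  by rewrite mulfV ?subrr // pnatr_eq0 -lt0n.
have /(_ j) := psumr_eq0P (fun k _ => gap0 k) sum0.
move=> /(_ erefl)/subr0_eq/esym/eqP; rewrite eqrXn2 //.
by move/eqP.
Qed.

Lemma unitary_hadamard A :
  (0 < N)%N -> A \is unitarymx -> exponent_bound A 1 ->
  hadamard (s%:C%C *: A).
Proof.
move=> N0 hA hb.
have s0 : 0 < s by rewrite sqrtr_gt0 ltr0n.
split=> [i j|i1 i2 ne|j1 j2 ne].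
- rewrite mxE normrM (unitary_exponent_bound1_norm N0 hA hb).
  by rewrite ger0_norm ?ler0c ?ltW // -rmorphM mulfV ?rmorph1 // gt_eqF.
- move/unitarymxP: hA => /(congr1 (fun M : 'M[R[i]]_N => M i1 i2)).
  rewrite !mxE (negPf ne) => h0.
  under eq_bigr => k _ do rewrite !mxE rmorphM mulrACA.
  rewrite -mulr_sumr -[RHS](mulr0 (s%:C%C * (s%:C%C)^*)); congr (_ * _).
  by rewrite -[RHS]h0; apply: eq_bigr => k _; rewrite !mxE.
(* Column orthogonality is row orthogonality of the transpose, which is unitary too. *)
- move: hA; rewrite -trmx_unitary => /unitarymxP.
  move=> /(congr1 (fun M : 'M[R[i]]_N => M j1 j2)).
  rewrite !mxE (negPf ne) => h0.
  under eq_bigr => k _ do rewrite !mxE rmorphM mulrACA.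
  rewrite -mulr_sumr -[RHS](mulr0 (s%:C%C * (s%:C%C)^*)); congr (_ * _).
  by rewrite -[RHS]h0; apply: eq_bigr => k _; rewrite !mxE.
Qed.

(** For [N > 1] the base [1/sqrt N] is below 1, so its powers with exponent above 1 drop below the
    entry [1/sqrt N]. For [N = 1] the base is 1 and this fails. *)
Lemma exponent_le1 A alpha (i0 j0 : 'I_N) :
  (1 < N)%N -> A i0 j0 = (s^-1)%:C%C -> exponent_bound A alpha -> alpha <= 1.
Proof.
move=> N1 A0 /exponent_boundP /(_ i0 j0).
have s1 : 1 < s by rewrite -[ltLHS]sqrtr1 ltr_sqrt ?ltr1n ?ltr0n // ltnW.
have s0 : 0 < s by exact: lt_trans s1.
rewrite A0 ger0_norm ?ler0c ?invr_ge0 ?(ltW s0) // lecR.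
move=> h; rewrite leNgt; apply/negP => a1; move: h; apply/negP; rewrite -ltNge.
rewrite -ltr_ln ?posrE ?powR_gt0 ?invr_gt0 // ln_powR lnV ?posrE //.
by rewrite gtr_nMl // oppr_lt0 ln_gt0.
Qed.

End ExponentBound.

(** Real entries of modulus one are signs, so orthogonality to the row of ones says that row [i1]
    sums to 0, and [N] is twice the number of its entries -1. *)
Lemma real_hadamard_even (R : realType) (N : nat) (H : 'M[R[i]]_N)
    (i0 i1 : 'I_N) :
  i1 != i0 -> (forall j, H i0 j = 1) -> (forall i j, H i j \is Num.real) ->
  hadamard H -> ~~ odd N.
Proof.
move=> ne H0 Hr [H1 Hrow _].
have := Hrow _ _ ne.
have sgn j : H i1 j = 1 - (H i1 j != 1)%:R *+ 2.
  have [->|ne1] := eqVneq (H i1 j) 1; first by rewrite mul0rn subr0.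
  have /eqP := H1 i1 j.
  rewrite real_eqr_norml // ler01 andbT (negPf ne1) /= => /eqP ->.
  by rewrite mulr2n opprD addNKr.
under eq_bigr => j _ do rewrite H0 conjC1 mulr1 sgn.
rewrite sumrB sumr_const card_ord sumrMnl -natr_sum => /subr0_eq/eqP.
by rewrite -mulrnA eqr_nat muln2 => /eqP->; rewrite odd_double.
Qed.

(** An admissible [alpha] is not determined by [A], as smaller positive exponents are admissible
    too. Hence (iii) is stated in two readings: admissibility of exponent 1, and [alpha = 1] for the
    largest admissible [alpha]. *)
Theorem theorem5p1 (R : realType) (N p : nat) (A : 'M[R[i]]_N)
    (f : 'cV[R[i]]_(N ^ p)) (alpha : R)
    (N_gt0 : (0 < N)%N) (p_ge1 : (1 <= p)%N)
    (A_unitary : A \is unitarymx)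
    (A_row0 : forall i j : 'I_N, val i = 0%N ->
       A i j = ((Num.sqrt N%:R)^-1 : R)%:C%C)
    (f_neq0 : f != 0)
    (alpha_gt0 : 0 < alpha) (A_alpha : exponent_bound A alpha) :
  [/\ N%:R `^ (p%:R * alpha)
        <= (#|supp f| * #|supp (walsh_transform A f)|)%:R :> R,
      forall N2 : N = 2%N, castmx (N2, N2) A = walsh2 R ->
        (N ^ p <= #|supp f| * #|supp (walsh_transform A f)|)%N,
      (exponent_bound A 1 <-> hadamard ((Num.sqrt N%:R : R)%:C%C *: A)) /\
      ((forall beta : R, 0 < beta -> exponent_bound A beta -> beta <= alpha) ->
        (alpha = 1 <-> hadamard ((Num.sqrt N%:R : R)%:C%C *: A)))
    & (forall i j : 'I_N, A i j \is Num.real) -> (2 < N)%N ->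
        ~ (~~ odd N /\ exists2 H : 'M[R[i]]_N,
             hadamard H & A = ((Num.sqrt N%:R)^-1 : R)%:C%C *: H) ->
        alpha < 1].
Proof.
move: A_row0 => A0; pose i0 := Ordinal N_gt0.
have hadE : exponent_bound A 1 <-> hadamard ((Num.sqrt N%:R : R)%:C%C *: A).
  by split; [exact: unitary_hadamard | exact: hadamard_exponent_bound1].
have le1 : (1 < N)%N -> alpha <= 1.
  by move=> N1; apply: (@exponent_le1 _ _ A alpha i0 i0) => //; exact: A0.
split.
- exact: uncertainty.
- move=> N2 AW; rewrite -(ler_nat R) natrX.
  (* All entries of the Walsh matrix have modulus [1/sqrt 2], so (i) can be applied with exponent 1
     in place of [alpha]. *)
  have A1 : exponent_bound A 1.
    apply/exponent_boundP => i j; rewrite powR_sqrtV1.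
    have /(congr1 (fun M : 'M[R[i]]_2 => `|M (cast_ord N2 i) (cast_ord N2 j)|)) := AW.
    rewrite castmxE !cast_ordK mxE /= => ->.
    by case: ifP => _; rewrite N2 ?normrN ger0_norm // ler0c invr_ge0 sqrtr_ge0.
  have := uncertainty N_gt0 A_unitary f_neq0 A1.
  by rewrite mulr1 powR_mulrn ?ler0n.
- split=> // amax.
  rewrite -hadE; split=> [<- //|A1].
  (* Maximality against exponent 1 gives [1 <= alpha]; the converse is [le1], once [N = 1] is
     excluded. *)
  apply/eqP; rewrite eq_le amax // andbT le1 // ltnNge; apply/negP => N1.
  (* For [N = 1] every exponent is admissible, so none is maximal. *)
  have {N1}N1 : N = 1%N by apply/eqP; rewrite eqn_leq N1.
  have : exponent_bound A (alpha + 1).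
    have s1 : Num.sqrt N%:R = 1 :> R by rewrite N1 sqrtr1.
    by move: A_alpha; rewrite /exponent_bound s1 invr1 !powR1.
  by move/amax => /(_ (addr_gt0 alpha_gt0 ltr01)); rewrite gerDl ler10.
- move=> Ar N2 nH.
  have N1 : (1 < N)%N by exact: ltn_trans N2.
  rewrite lt_neqAle le1 // andbT; apply/eqP => a1; apply: nH.
  rewrite a1 in A_alpha; have hH := hadE.1 A_alpha.
  split; last by exists ((Num.sqrt N%:R : R)%:C%C *: A) => //; exact: scale_sqrtK.
  (* Evenness comes from rows 0 and 1 of [sqrt N] times [A]; scaling turns row 0 into ones. *)
  apply: (@real_hadamard_even _ _ _ i0 (Ordinal N1)) hH => //.
  + move=> j; rewrite mxE A0 // -rmorphM mulfV ?rmorph1 //.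
    by rewrite gt_eqF // sqrtr_gt0 ltr0n.
  + by move=> i j; rewrite mxE rpredM // ger0_real // ler0c sqrtr_ge0.
Qed.
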